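(* Let $d\ge 1$ be an integer. The $d$-dimensional Friedman random walk $(\mathbf{X}_n)_{n\ge 0}$ is recurrent if $d=1$ or $d=2$ (i.e. every state of the walk is recurrent), and is transient if $d\ge 3$ (i.e. every state of the walk is transient).
   Context: Friedman urn: an urn initially contains one white ball and no blue balls. At each unit of discrete time a ball is drawn uniformly at random from the urn and is returned to the urn together with one additional ball of the opposite color. Let $W_n$ and $B_n$ be the numbers of white and blue draws among the first $n$ draws, so $W_n+B_n=n$; after $n$ draws the urn contains $B_n+1$ white balls and $W_n$ blue balls. One-dimensional Friedman random walk: a particle starts at the origin, $X_0=0$, and after each draw moves by $+1$ if the drawn ball is white and by $-1$ if it is blue, so $X_n=W_n-B_n\in\mathbb{Z}$. $d$-dimensional Friedman random walk: $\mathbf{X}_n=(X_n^{(1)},\ldots,X_n^{(d)})$, where $X_n^{(1)},\ldots,X_n^{(d)}$ are independent one-dimensional Friedman random walks, each driven by its own independent Friedman urn. Thus all coordinates change by $\pm1$ at each step. The states of the walk are the points of $\mathbb{Z}^d$ that it can reach from the origin with positive probability. Recurrence: a state is recurrent if the particle's probability of returning to it infinitely often is $1$; a state that is not recurrent is transient. The walk is recurrent (transient) if all its states are recurrent (transient). *)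

(* Defs.v *)
From HB Require Import structures.
From mathcomp Require Import all_boot all_order all_algebra.
From mathcomp Require Import all_classical all_reals all_analysis.

Set Implicit Arguments.
Unset Strict Implicit.
Unset Printing Implicit Defensive.

Import Order.TTheory GRing.Theory Num.Theory.
Import numFieldNormedType.Exports.

Local Open Scope classical_set_scope.
Local Open Scope ring_scope.

(* A colour is a boolean, [true] for white and [false] for blue.  The contents
   of an urn are a pair (number of white balls, number of blue balls). *)
Definition color := bool.
Definition urn := (nat * nat)%type.

Definition balls (u : urn) (c : color) : nat := if c then u.1 else u.2.

Definition urn_size (u : urn) : nat := (u.1 + u.2)%N.

Definition add_opposite (u : urn) (c : color) : urn :=
  if c then (u.1, u.2.+1) else (u.1.+1, u.2).

Definition urn_after (h : seq color) : urn := foldl add_opposite (1, 0)%N h.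

Section Urn.
Context {dT : measure_display} {T : measurableType dT} {R : realType}.
Variable P : probability T R.
(* [D k] is the colour of the draw number k.+1. *)
Variable D : nat -> {RV P >-> bool}.

Definition history (n : nat) (w : T) : seq color := mkseq (fun k => D k w) n.

(* Given the colours h of the first n draws, the next ball is uniform in the
   urn; written as P(h and then c) = P(h) * (share of c in the urn after h), so
   that nothing is required after histories of probability zero. *)
Definition friedman_urn : Prop :=
  forall (n : nat) (h : seq color) (c : color), size h = n ->
    P [set w | history n w = h /\ D n w = c] =
    (P [set w | history n w = h] *
     ((balls (urn_after h) c)%:R / (urn_size (urn_after h))%:R)%:E)%E.

Definition white_draws (n : nat) (w : T) : nat :=
  count (pred1 true) (history n w).

Definition blue_draws (n : nat) (w : T) : nat :=
  count (pred1 false) (history n w).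

Definition friedman_walk1 (n : nat) (w : T) : int :=
  (white_draws n w)%:Z - (blue_draws n w)%:Z.

Definition sigma_process : set (set T) :=
  <<s \bigcup_n preimage_set_system setT (D n) measurable >>.

End Urn.

Section Walk.
Context {dT : measure_display} {T : measurableType dT} {R : realType}.
Variable P : probability T R.

Definition independent_families (I : finType) (F : I -> set (set T)) : Prop :=
  forall (J : {set I}) (A : I -> set T), (forall i, i \in J -> F i (A i)) ->
    P (\bigcap_(i in [set` J]) A i) = (\prod_(i in J) P (A i))%E.

Definition friedman_walk (d : nat) (D : 'I_d -> nat -> {RV P >-> bool})
    (n : nat) (w : T) : 'rV[int]_d :=
  \row_i friedman_walk1 (D i) n w.

Definition walk_state (S : Type) (X : nat -> T -> S) (x : S) : Prop :=
  exists n, (0 < P [set w | X n w = x])%E.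

Definition recurrent_state (S : Type) (X : nat -> T -> S) (x : S) : Prop :=
  P (lim_sup_set (fun n => [set w | X n w = x])) = 1%E.

Definition transient_state (S : Type) (X : nat -> T -> S) (x : S) : Prop :=
  ~ recurrent_state X x.

Definition recurrent_walk (S : Type) (X : nat -> T -> S) : Prop :=
  forall x, walk_state X x -> recurrent_state X x.

Definition transient_walk (S : Type) (X : nat -> T -> S) : Prop :=
  forall x, walk_state X x -> transient_state X x.

End Walk.

(* Main.v *)
Require Import Defs.
From HB Require Import structures.
From mathcomp Require Import all_boot all_order all_algebra.
From mathcomp Require Import all_classical all_reals all_analysis.
From mathcomp Require Import ring lra zify.

(** Let [Y] be a coordinate of the walk minus 1.  After [n] draws the urn is
    determined by [Y], and [Y] steps up with probability
    [(n + 1 - Y) / (2 (n + 1))] and down otherwise: a nearest-neighbour chain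
    with drift [- Y / (n + 1)] towards the origin.  The drift keeps the standard
    deviation of order [sqrt n], so the walk should visit a point as rarely as
    the simple random walk does.

    Transience for [d >= 3].  Let [q n y] be the probability that [Y = y] after
    [n] draws.  An induction on [n] along the recursion of [q] shows that
    [q n (y + 2)] is at least [(1 - 8 (y + 2) / n) q n y] for [y >= 0]
    ([q_ratio]).  Hence about [sqrt n] neighbours of [y] have at least half of
    its mass; since the total mass is 1, [q n y] is [O(1 / sqrt n)]
    ([q_sqrt_bound]).  By independence the walk in dimension [d] is at a given
    point with probability [O(n^(- 3 / 2))], and the Borel-Cantelli lemma
    applies.

    Recurrence for [d = 1, 2].  In both cases there is a function of the
    position that tends to infinity and is a supermartingale outside a bounded
    set: the absolute value in dimension one ([abs_supermartingale]) and, in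
    dimension two, the logarithm of the squared norm minus 7
    ([log_supermartingale]); the drift, being directed inwards, only improves
    the inequalities known for the simple random walk.  So the walk returns to a
    bounded set, from which it reaches a prescribed state within a bounded
    number of steps with a probability bounded below, whatever the time
    ([lyapunov_recurrence]).  Hence after any time it hits the state almost
    surely.  The argument is carried out on the tree of finite histories, on the
    masses of histories that are never followed by a visit to the state. *)

Set Implicit Arguments.
Unset Strict Implicit.
Unset Printing Implicit Defensive.

Import Order.TTheory GRing.Theory Num.Theory.
Import numFieldNormedType.Exports.

Local Open Scope classical_set_scope.
Local Open Scope ring_scope.

(** * The centred walk along a history *)

Definition sign_of (c : bool) : int := if c then 1 else -1.

(** The walk minus 1, its centre of symmetry from time one on.  After [n]
    draws the shifted walk has drift [- y / n.+1], directed towards 0. *)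
Definition centred (h : seq bool) : int :=
  (count_mem true h)%:Z - (count_mem false h)%:Z - 1.

Lemma centred_rcons h c : centred (rcons h c) = centred h + sign_of c.
Proof.
rewrite /centred -cats1 !count_cat /=.
by case: c; rewrite /= /sign_of; lia.
Qed.

Lemma centred_parity h :
  centred h + (size h).+1%:Z = (count_mem true h).*2%:Z.
Proof.
have := count_predC (pred1 true) h.
rewrite (@eq_count _ (predC (pred1 true)) (pred1 false)); last by case.
by rewrite /centred => <-; lia.
Qed.

Lemma normr_centred h : `|centred h| <= (size h).+1%:Z.
Proof.
have := count_predC (pred1 true) h.
rewrite (@eq_count _ (predC (pred1 true)) (pred1 false)); last by case.
by rewrite /centred => <-; lia.
Qed.

Section DrawProbability.
Variable R : realType.

Definition draw_prob (n : nat) (y : int) (c : bool) : R :=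
  (n.+1%:R - (sign_of c * y)%:~R) / (2 * n.+1%:R).

Lemma draw_prob_sum n y : draw_prob n y true + draw_prob n y false = 1.
Proof.
rewrite /draw_prob /sign_of mul1r mulN1r rmorphN /= opprK.
have n0 : n.+1%:R != 0 :> R by rewrite pnatr_eq0.
by field.
Qed.

Lemma draw_prob_ge4 n y c :
  2 * (sign_of c * y) <= n.+1%:Z -> 4^-1 <= draw_prob n y c.
Proof.
rewrite -(ler_int R) rmorphM/= => yn.
rewrite /draw_prob ler_pdivlMr ?mulr_gt0 ?ltr0n//.
have yn' : 2 * (sign_of c * y)%:~R <= n.+1%:R :> R := yn.
by move: yn'; set z := (_ * y)%:~R; lra.
Qed.

(** The Markov property comes from here: the time and the position determine
    both numbers of draws, hence the whole content of the urn. *)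
Lemma urn_share h c :
  (balls (urn_after h) c)%:R / (urn_size (urn_after h))%:R =
  draw_prob (size h) (centred h) c.
Proof.
have -> : urn_after h = ((count_mem false h).+1, count_mem true h).
  elim/last_ind: h => [//|h b IH].
  rewrite /urn_after -cats1 foldl_cat -/(urn_after h) IH !count_cat /=.
  by case: b; rewrite /add_opposite /= ?(addn0, addn1).
have sz : size h = (count_mem true h + count_mem false h)%N.
  rewrite -(count_predC (pred1 true) h); congr addn.
  by apply: eq_count; case.
rewrite /urn_size /balls /draw_prob /centred sz /=.
set W := count_mem true h; set B := count_mem false h.
have n0 : (W + B).+1%:R != 0 :> R by rewrite pnatr_eq0.
rewrite addSn (addnC B); case: c => /=; rewrite /sign_of ?mul1r ?mulN1r.
  rewrite !rmorphB /= -!pmulrn -!natr1 natrD.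
  by field; rewrite -natrD natr1.
rewrite rmorphN !rmorphB /= -!pmulrn -!natr1 natrD.
by field; rewrite -natrD natr1.
Qed.

End DrawProbability.

(** * A recurrence criterion on the tree of histories *)

Lemma geometric_le0 (R : realType) (g r c : R) : 0 <= r -> r < 1 ->
  (forall j, g <= r ^+ j * c) -> g <= 0.
Proof.
move=> r0 r1 H.
have cv : (fun j => r ^+ j * c) @ \oo --> (0 : R).
  rewrite -(mul0r c); apply: cvgMl; apply: cvg_expr.
  by rewrite ger0_norm.
rewrite -(cvg_lim (@Rhausdorff R) cv); apply: limr_ge; first by apply/cvg_ex; exists 0.
by near=> j; exact: H.
Unshelve. all: by end_near.
Qed.

Section HistoryTree.
Variables (R : realType) (d : nat).

Definition draws := {ffun 'I_d -> bool}.

Definition marginal (h : seq draws) (i : 'I_d) : seq bool :=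
  [seq (c : draws) i | c : draws <- h].

Definition position (h : seq draws) (i : 'I_d) : int := centred (marginal h i).

Definition step_prob (h : seq draws) (c : draws) : R :=
  \prod_i draw_prob R (size h) (position h i) (c i).

Lemma position_rcons h c i :
  position (rcons h c) i = position h i + sign_of (c i).
Proof. by rewrite /position /marginal map_rcons centred_rcons. Qed.

Lemma normr_position h i : `|position h i| <= (size h).+1%:Z.
Proof. by have := normr_centred (marginal h i); rewrite size_map. Qed.

Lemma step_prob_sum h : \sum_c step_prob h c = 1.
Proof.
rewrite /step_prob -(bigA_distr_bigA (fun i b => draw_prob R (size h) (position h i) b)) /=.
by apply: big1 => i _; rewrite big_bool /= draw_prob_sum.
Qed.

(** [M] is the law of the histories.  All estimates below compare functions of
    a history with multiples of [M], which avoids conditioning on histories of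
    probability zero. *)
Variable M : seq draws -> R.
Hypothesis M_ge0 : forall h, 0 <= M h.
Hypothesis M_rcons : forall h c, M (rcons h c) = M h * step_prob h c.

Variable a : 'I_d -> int.
Variables (K N : nat).
Hypothesis aK : forall i, `|a i| <= K%:Z.
(* Every history gives all coordinates the parity of its length plus one; the
   target has to be in the same situation at some time [N] to be reachable. *)
Hypothesis aN : forall i, exists W : nat, a i + N.+1%:Z = W.*2%:Z.

Definition near_target (k : nat) (h : seq draws) :=
  forall i, `|position h i - a i| <= k%:Z.

Definition min_step : R := 4^-1 ^+ d.

Lemma min_step_gt0 : 0 < min_step. Proof. by rewrite exprn_gt0// invr_gt0 ltr0n. Qed.
Lemma min_step_le1 : min_step <= 1.
Proof. by rewrite exprn_ile1// ?invr_ge0 ?ler0n// invf_le1// ler1n. Qed.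

Lemma sum_M_rcons h : \sum_c M (rcons h c) = M h.
Proof.
under eq_bigr do rewrite M_rcons.
by rewrite -mulr_sumr step_prob_sum mulr1.
Qed.

(** Each coordinate moves towards its target; one that has already arrived
    steps up, and comes back at the next step. *)
Definition greedy (h : seq draws) : draws := [ffun i => position h i <= a i].

(** The distances of the coordinates to their targets have a common parity.  So
    if some coordinate has arrived and is pushed off by one step, the largest
    distance was at least 2, and it still decreases. *)
Lemma near_target_greedy k h : ~ near_target 0 h -> near_target k.+1 h ->
  near_target k (rcons h (greedy h)).
Proof.
move=> n0 nk i.
have odd_eq j : exists z : int,
    (position h j - a j) = (position h i - a i) + 2 * z.
  have [Wi eWi] := aN i; have [Wj eWj] := aN j.
  have := centred_parity (marginal h i); have := centred_parity (marginal h j).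
  rewrite !size_map -/(position h i) -/(position h j) => ej ei.
  exists ((count_mem true (marginal h j))%:Z - Wj%:Z
          - (count_mem true (marginal h i))%:Z + Wi%:Z).
  lia.
rewrite position_rcons ffunE; have := nk i.
have [le|gt] := leP (position h i) (a i); rewrite /sign_of; last by lia.
have [lt _|eq] := ltP (position h i) (a i); first by have := nk i; lia.
have ei : position h i - a i = 0 by lia.
case: k nk => [nk|k nk]; last by lia.
case: n0 => j; have := nk j; have [z] := odd_eq j.
by rewrite ei; lia.
Qed.

(** A step towards the origin has probability at least one half.  A greedy step
    leads away from the origin only at positions no farther than [K], where from
    time [2 K] on each direction still has probability at least one quarter. *)
Lemma step_prob_greedy h : (K.*2 <= size h)%N -> min_step <= step_prob h (greedy h).
Proof.
move=> Kh; rewrite /min_step /step_prob -[d in X in X <= _]card_ord -prodr_const.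
apply: ler_prod => i _; rewrite invr_ge0 ler0n /=.
apply: draw_prob_ge4; rewrite ffunE; have := aK i.
by have [le|gt] := leP (position h i) (a i); rewrite /sign_of; lia.
Qed.

Variable n0 : nat.
Hypothesis Kn0 : (K.*2 <= n0)%N.

(** [G] is subharmonic outside [B].  Following the greedy path for [k] steps
    either enters [B], where [G] is nonpositive, or ends at the target, which
    belongs to [B].  The path has probability at least [min_step ^+ k], and only
    the remaining mass can contribute [w]. *)
Lemma contraction (G : seq draws -> R) (B : seq draws -> Prop) (w : R) :
  0 <= w ->
  (forall h, n0 <= size h -> near_target 0 h -> B h)%N ->
  (forall h, (n0 <= size h)%N -> B h -> G h <= 0) ->
  (forall h, (n0 <= size h)%N -> ~ B h -> G h <= \sum_c G (rcons h c)) ->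
  (forall h, (n0 <= size h)%N -> G h <= w * M h) ->
  forall k h, (n0 <= size h)%N -> near_target k h ->
    G h <= (1 - min_step ^+ k) * w * M h.
Proof.
move=> w0 tB GB Gsub Gw; elim=> [|k IH] h hn hk.
  by rewrite expr0 subrr !mul0r; apply: GB => //; apply: tB.
have [Bh|nBh] := pselect (B h).
  rewrite (le_trans (GB _ hn Bh))// !mulr_ge0// subr_ge0 exprn_ile1//.
    by rewrite ltW// min_step_gt0.
  by rewrite min_step_le1.
have hc c : (n0 <= size (rcons h c))%N by rewrite size_rcons ltnW.
apply: le_trans (Gsub _ hn nBh) _.
rewrite (bigD1 (greedy h))//=.
have IHg := IH _ (hc (greedy h)) (near_target_greedy (fun t => nBh (tB _ hn t)) hk).
have rest : \sum_(c | c != greedy h) G (rcons h c) <=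
            \sum_(c | c != greedy h) w * M (rcons h c).
  by apply: ler_sum => c _; exact: Gw.
apply: le_trans (lerD IHg rest) _.
have := sum_M_rcons h; rewrite (bigD1 (greedy h))//= -mulr_sumr.
set S := \sum_(c | _) _ => eS.
have -> : S = M h - M (rcons h (greedy h)) by rewrite -eS; ring.
rewrite exprS.
have : min_step * M h <= M (rcons h (greedy h)).
  rewrite M_rcons mulrC ler_wpM2l//; apply: step_prob_greedy.
  exact: leq_trans Kn0 hn.
have : 0 <= min_step ^+ k * w by rewrite mulr_ge0 ?exprn_ge0// ltW// min_step_gt0.
set e := min_step ^+ k * w; set Mg := M (rcons _ _) => e0 le.
have -> : (1 - min_step ^+ k) * w * Mg = w * Mg - e * Mg by rewrite /e; ring.
have -> : (1 - min_step * min_step ^+ k) * w * M h = w * M h - e * (min_step * M h).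
  by rewrite /e; ring.
have := ler_wpM2l e0 le; lra.
Qed.

Lemma min_step_ratio k : 0 <= 1 - min_step ^+ k < 1.
Proof.
rewrite subr_ge0 exprn_ile1 ?min_step_le1 ?(ltW min_step_gt0)//=.
by rewrite ltrBlDr ltrDl exprn_gt0// min_step_gt0.
Qed.

(** [Q h] stands for the probability of having history [h] and never hitting
    the target afterwards.  If [Q <= w M], then on the bounded set [A] greedy
    paths improve the factor to [s = (1 - min_step ^+ kA) * w], by the contraction
    lemma for the target alone.  Outside [A] the function
    [Q - (s + e f) M] is still subharmonic, it is nonpositive on [A] and where
    [f] is large, and the remaining region is bounded: the same contraction,
    iterated, makes it nonpositive everywhere.  Letting [e] tend to 0 gives
    [Q <= s M] without restriction, and iterating this gives [Q <= 0]. *)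
Lemma lyapunov_recurrence (Q f : seq draws -> R) (A : seq draws -> Prop)
    (kA : nat) :
  (forall h, (n0 <= size h)%N -> Q h <= M h) ->
  (forall h, (n0 <= size h)%N -> near_target 0 h -> Q h <= 0) ->
  (forall h, (n0 <= size h)%N -> ~ near_target 0 h ->
     Q h <= \sum_c Q (rcons h c)) ->
  (forall h, 0 <= f h) ->
  (forall h, (n0 <= size h)%N -> ~ A h ->
     \sum_c step_prob h c * f (rcons h c) <= f h) ->
  (forall h, A h -> near_target kA h) ->
  (forall t, exists k, forall h, f h < t -> near_target k h) ->
  forall h, (n0 <= size h)%N -> Q h <= 0.
Proof.
move=> QM Q0 Qsub f0 fsup Anear fnear.
have step w : 0 <= w -> (forall h, (n0 <= size h)%N -> Q h <= w * M h) ->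
    forall h, (n0 <= size h)%N -> Q h <= (1 - min_step ^+ kA) * w * M h.
  move=> w0 Qw.
  have Qnear := @contraction Q (near_target 0) w w0 (fun _ _ t => t) Q0 Qsub Qw kA.
  have /andP[r0 _] := min_step_ratio kA.
  set s := (1 - min_step ^+ kA) * w; have s0 : 0 <= s by rewrite mulr_ge0.
  have eps_bound e : 0 < e -> forall h, (n0 <= size h)%N ->
      Q h - (s + e * f h) * M h <= 0.
    move=> e0.
    pose G h := Q h - (s + e * f h) * M h.
    pose B h := [\/ A h, near_target 0 h | w <= e * f h].
    have [k fk] := fnear (w / e).
    have /andP[q0 q1] := min_step_ratio k.
    have GB h : (n0 <= size h)%N -> B h -> G h <= 0.
      move=> hn; rewrite /G subr_le0 mulrDl => -[Ah|th|wf].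
      - rewrite (le_trans (Qnear _ hn (Anear _ Ah)))// lerDl.
        by rewrite !mulr_ge0// ltW.
      - rewrite (le_trans (Q0 _ hn th))// addr_ge0// !mulr_ge0//.
        exact: ltW.
      - rewrite (le_trans (Qw _ hn))//.
        have := ler_wpM2r (M_ge0 h) wf.
        have := mulr_ge0 s0 (M_ge0 h); lra.
    have Gsub h : (n0 <= size h)%N -> ~ B h -> G h <= \sum_c G (rcons h c).
      move=> hn nB; rewrite /G sumrB lerB//.
        by apply: Qsub => // th; apply: nB; constructor 2.
      have nA : ~ A h by move=> Ah; apply: nB; constructor 1.
      have -> : \sum_c (s + e * f (rcons h c)) * M (rcons h c) =
          s * M h + e * M h * \sum_c step_prob h c * f (rcons h c).
        rewrite -{1}(sum_M_rcons h) !mulr_sumr -big_split /=.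
        by apply: eq_bigr => c _; rewrite M_rcons; ring.
      rewrite mulrDl lerD2l [leRHS]mulrAC ler_wpM2l//.
        by rewrite mulr_ge0// ltW.
      exact: fsup.
    have tB h : (n0 <= size h)%N -> near_target 0 h -> B h.
      by move=> _ th; constructor 2.
    have GwM h : (n0 <= size h)%N -> G h <= w * M h.
      move=> hn; rewrite (le_trans _ (Qw _ hn))// /G gerBl.
      by rewrite mulr_ge0// addr_ge0// mulr_ge0// ltW.
    have iter j h : (n0 <= size h)%N -> G h <= (1 - min_step ^+ k) ^+ j * w * M h.
      elim: j h => [|j IHj] h hn; first by rewrite expr0 mul1r; exact: GwM.
      have w'0 : 0 <= (1 - min_step ^+ k) ^+ j * w by rewrite mulr_ge0// exprn_ge0.
      have [Bh|nBh] := pselect (B h).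
        by rewrite (le_trans (GB _ hn Bh))// !mulr_ge0// exprn_ge0.
      rewrite exprS -[_ * _ * w]mulrA.
      apply: (contraction w'0 tB GB Gsub IHj) => //; apply: fk.
      rewrite ltr_pdivlMr// mulrC ltNge; apply/negP => wf.
      by apply: nBh; constructor 3.
    move=> h hn; apply: (@geometric_le0 R (G h) _ (w * M h) q0 q1) => j.
    by rewrite mulrA; exact: iter.
  move=> h hn; rewrite -subr_le0; apply/ler_addgt0Pr => e e0.
  rewrite add0r.
  have fM0 : 0 < 1 + f h * M h by rewrite ltr_pwDl// mulr_ge0.
  have := eps_bound (e / (1 + f h * M h)) (divr_gt0 e0 fM0) h hn.
  have : e / (1 + f h * M h) * (f h * M h) <= e.
    rewrite mulrAC ler_pdivrMr// ler_wpM2l ?(ltW e0)// lerDr//.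
  set z := e / _; lra.
have /andP[r0 r1] := min_step_ratio kA.
move=> h hn; apply: (@geometric_le0 R (Q h) _ (M h) r0 r1) => j.
elim: j h hn => [|j IHj] h hn; first by rewrite expr0 mul1r; exact: QM.
rewrite exprS; apply: step => //; exact: exprn_ge0.
Qed.

End HistoryTree.

(** * Lyapunov functions in dimensions one and two *)

Section Lyapunov.
Variable R : realType.

Lemma sum_draws1 (F : draws 1 -> R) :
  \sum_c F c = F [ffun=> true] + F [ffun=> false].
Proof.
rewrite (reindex (fun b : bool => [ffun=> b] : draws 1)) /=.
  by rewrite big_bool.
apply: onW_bij; exists (fun c : draws 1 => c ord0) => [b|c].
  by rewrite ffunE.
by apply/ffunP => i; rewrite ffunE (ord1 i).
Qed.

Definition draws_pair (p : bool * bool) : draws 2 :=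
  [ffun i => if i == ord0 then p.1 else p.2].

Lemma sum_draws2 (F : draws 2 -> R) :
  \sum_c F c = F (draws_pair (true, true)) + F (draws_pair (true, false))
             + (F (draws_pair (false, true)) + F (draws_pair (false, false))).
Proof.
rewrite (reindex draws_pair) /=.
  rewrite -(pair_bigA _ (fun b1 b2 => F (draws_pair (b1, b2)))) /=.
  by rewrite big_bool /= !big_bool /=.
apply: onW_bij; exists (fun c : draws 2 => (c ord0, c ord_max)) => [[b1 b2]|c].
  by rewrite !ffunE.
apply/ffunP => i; rewrite ffunE /=; case: eqP => [->//|ni].
by congr (c _); apply/val_inj => /=; case: i ni => [[|[|]]] //= p; case; apply/val_inj.
Qed.

(** Away from 0 the absolute value is affine along a step, so only the inward
    drift is seen. *)
Lemma abs_supermartingale (h : seq (draws 1)) : position h ord0 <> 0 ->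
  \sum_c step_prob R h c * `|position (rcons h c) ord0|%:~R
    <= `|position h ord0|%:~R.
Proof.
move=> y0; rewrite sum_draws1 /step_prob !big_ord1 !position_rcons !ffunE.
move: (position h ord0) y0 => y y0; rewrite /draw_prob /sign_of mul1r mulN1r.
have n0 : 0 < (size h).+1%:R :> R by rewrite ltr0n.
set n : R := (size h).+1%:R in n0 *.
rewrite rmorphN /=.
have [yp|yn] : 1 <= y \/ y <= -1 by lia.
- have -> : `|y + 1| = y + 1 by lia.
  have -> : `|y + -1| = y - 1 by lia.
  have -> : `|y| = y by lia.
  rewrite rmorphB rmorphD /=; have : 0 <= y%:~R :> R by rewrite ler0z; lia.
  set z : R := y%:~R => z0.
  rewrite -subr_ge0.
  have -> : z - ((n - z) / (2 * n) * (z + 1) + (n - - z) / (2 * n) * (z - 1))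
      = z / n by field; rewrite gt_eqF.
  by rewrite divr_ge0// ltW.
- have -> : `|y + 1| = - y - 1 by lia.
  have -> : `|y + -1| = - y + 1 by lia.
  have -> : `|y| = - y by lia.
  rewrite !(rmorphD, rmorphN) /=; have : y%:~R <= 0 :> R by rewrite lerz0; lia.
  set z : R := y%:~R => z0.
  rewrite -subr_ge0.
  have -> : - z - ((n - z) / (2 * n) * (- z - 1) + (n - - z) / (2 * n) * (- z + 1))
      = - z / n by field; rewrite gt_eqF.
  by rewrite divr_ge0 ?oppr_ge0// ltW.
Qed.

(** Third-order Taylor polynomials bound the logarithm from above on the whole
    half-line, because the derivative of the difference is
    [(x - 1) ^+ 3 / x], of the sign of [x - 1]. *)
Lemma ln1Dx_le3 (u : R) : -1 < u -> ln (1 + u) <= u - u ^+ 2 / 2 + u ^+ 3 / 3.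
Proof.
move=> u1.
pose g : R -> R := (id - cst 1) - 2^-1 *: (id - cst 1) ^+ 2
  + 3^-1 *: (id - cst 1) ^+ 3 - @ln R.
have dg (x : R) : 0 < x -> is_derive x 1 g ((x - 1) ^+ 3 / x).
  move=> x0; have dl := is_derive1_ln x0.
  have did : is_derive x 1 (id - cst 1 : R -> R) 1.
    by apply: is_derive_eq; rewrite subr0.
  have h := is_deriveB (is_deriveD (is_deriveB did
    (is_deriveZ 2^-1 (is_deriveX 2 did))) (is_deriveZ 3^-1 (is_deriveX 3 did))) dl.
  apply: (is_derive_eq h).
  rewrite /GRing.scale /= /cst /= -[(_ - _ : R -> R) x]/(x - 1) !mulr1.
  by field; rewrite gt_eqF.
have cg (x y : R) : 0 < x -> {within `[x, y], continuous g}.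
  move=> x0; apply: derivable_within_continuous => z.
  rewrite in_itv /= => /andP[xz _].
  by have [] := dg z (lt_le_trans x0 xz).
have g1 : g 1 = 0.
  rewrite /g -[LHS]/((1 - 1) - 2^-1 * (1 - 1) ^+ 2 + 3^-1 * (1 - 1) ^+ 3 - ln 1).
  by rewrite ln1 subrr !expr0n /= !mulr0 !subr0 addr0.
have gu : g (1 + u) = u - u ^+ 2 / 2 + u ^+ 3 / 3 - ln (1 + u).
  rewrite /g -[LHS]/((1 + u - 1) - 2^-1 * (1 + u - 1) ^+ 2
    + 3^-1 * (1 + u - 1) ^+ 3 - ln (1 + u)).
  by field.
rewrite -subr_ge0 -gu.
have [u0|u0|->] := ltgtP u 0; last by rewrite addr0 g1.
- have lt1 : 1 + u < 1 by lra.
  have dg' x : x \in `](1 + u), 1[%R -> is_derive x 1 g ((x - 1) ^+ 3 / x).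
    by rewrite in_itv /= => /andP[xu _]; apply: dg; lra.
  have cg' : {within `[(1 + u), 1], continuous g} by apply: cg; lra.
  have [c + eg] := MVT lt1 dg' cg'.
  rewrite in_itv /= => /andP[cu c1].
  have c0 : 0 < c by lra.
  suff : g 1 - g (1 + u) <= 0 by rewrite g1 sub0r oppr_le0.
  rewrite eg mulr_le0_ge0//; last lra.
  rewrite mulr_le0_ge0 ?invr_ge0 ?(ltW c0)//.
  by rewrite exprS mulr_le0_ge0 ?sqr_ge0// subr_le0 ltW.
- have lt1 : 1 < 1 + u by lra.
  have dg' x : x \in `]1, (1 + u)[%R -> is_derive x 1 g ((x - 1) ^+ 3 / x).
    by rewrite in_itv /= => /andP[xu _]; apply: dg; lra.
  have cg' : {within `[1, (1 + u)], continuous g} by apply: cg; lra.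
  have [c + eg] := MVT lt1 dg' cg'.
  rewrite in_itv /= => /andP[c1 cu].
  suff : 0 <= g (1 + u) - g 1 by rewrite g1 subr0.
  rewrite eg mulr_ge0//; last lra.
  by rewrite divr_ge0 ?exprn_ge0//; lra.
Qed.

(** The logarithm of the squared norm is harmonic for planar Brownian motion,
    so for the walk the sign of its drift is decided by lower-order terms.  The
    inward drift of the walk only helps.  Taking the logarithm of [t = s - 7],
    where [s] is the squared norm, makes the other terms negative: multiplied by
    [3 t ^+ 3 / 2], the expectation of the Taylor polynomial gains [- 21 t] from
    the shift, which absorbs the [9 t] that remain without it. *)
Lemma log_drift (n y z t : R) : 0 < n -> 57 <= t -> y ^+ 2 + z ^+ 2 = t + 7 ->
  `|y| <= n -> `|z| <= n ->
  let p (e f : R) := (n - e * y) / (2 * n) * ((n - f * z) / (2 * n)) in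
  let l (e f : R) := ln (t + 2 * (e * y + f * z) + 2) in
  p 1 1 * l 1 1 + p 1 (-1) * l 1 (-1) + (p (-1) 1 * l (-1) 1 + p (-1) (-1) * l (-1) (-1))
  <= ln t.
Proof.
move=> n0 t57 st yn zn; set p := fun e f : R => _; set l := fun e f : R => ln _; cbv zeta.
have t0 : 0 < t by lra.
pose P (u : R) := u - u ^+ 2 / 2 + u ^+ 3 / 3.
pose v e f := 2 * (e * y + f * z + 1) / t.
have sq1 (e : R) : e = 1 \/ e = -1 -> e ^+ 2 = 1.
  by case=> ->; rewrite ?sqrrN expr1n.
have pe e f : e = 1 \/ e = -1 -> f = 1 \/ f = -1 -> 0 <= p e f.
  by rewrite /p; move: yn zn; rewrite !ler_norml => /andP[? ?] /andP[? ?] [] -> [] ->;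
    rewrite mulr_ge0// divr_ge0//; lra.
have le_ e f : e = 1 \/ e = -1 -> f = 1 \/ f = -1 -> l e f <= ln t + P (v e f).
  move=> he hf.
  have A2 : (e * y + f * z) ^+ 2 <= 2 * (t + 7).
    rewrite -st; have := sq1 _ he; have := sq1 _ hf => f2 e2.
    have -> : (e * y + f * z) ^+ 2 = e ^+ 2 * y ^+ 2 + f ^+ 2 * z ^+ 2 + 2 * (e * y) * (f * z) by ring.
    have := sqr_ge0 (e * y - f * z).
    have -> : (e * y - f * z) ^+ 2 = e ^+ 2 * y ^+ 2 + f ^+ 2 * z ^+ 2 - 2 * (e * y) * (f * z) by ring.
    rewrite e2 f2; lra.
  have v1 : -1 < v e f.
    rewrite /v ltr_pdivlMr// mulN1r.
    move: A2; set A := _ + _ => A2; nra.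
  have -> : l e f = ln t + ln (1 + v e f).
    rewrite -lnM ?posrE//; last lra.
    rewrite /l; congr ln; rewrite /v; field; lra.
  by rewrite lerD2l ln1Dx_le3.
have o1 : (1 : R) = 1 \/ (1 : R) = -1 by left.
have o2 : (-1 : R) = 1 \/ (-1 : R) = -1 by right.
have b11 := ler_wpM2l (pe _ _ o1 o1) (le_ _ _ o1 o1).
have b12 := ler_wpM2l (pe _ _ o1 o2) (le_ _ _ o1 o2).
have b21 := ler_wpM2l (pe _ _ o2 o1) (le_ _ _ o2 o1).
have b22 := ler_wpM2l (pe _ _ o2 o2) (le_ _ _ o2 o2).
apply: le_trans (lerD (lerD b11 b12) (lerD b21 b22)) _.
rewrite -subr_le0.
set D := (X in X <= 0).
pose s := t + 7; pose q := y ^+ 2 * z ^+ 2.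
(* The expectation of the Taylor polynomial in closed form; every term but the
   constant 88 is nonpositive, and [12 t] dominates 88. *)
have -> : D = 2 / (3 * t ^+ 3) *
   (- 12 * t + 88 - (6 * t - 24) * q / n ^+ 2
    - (3 * t ^+ 2 * s - 6 * t * s + 12 * s + 4 * (s ^+ 2 + 4 * q)) / n).
  have ez : z ^+ 2 = t + 7 - y ^+ 2 by rewrite -st; ring.
  have ez3 : z ^+ 3 = (t + 7 - y ^+ 2) * z by rewrite -ez; ring.
  have ez4 : z ^+ 4 = (t + 7 - y ^+ 2) ^+ 2 by rewrite -ez; ring.
  have et : t = y ^+ 2 + z ^+ 2 - 7 by rewrite st; ring.
  have tn0 : y ^+ 2 + z ^+ 2 - 7 != 0 by rewrite -et gt_eqF.
  rewrite /D /P /p /v /q /s et; field; rewrite tn0 /=; rewrite gt_eqF//.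
have q0 : 0 <= q by rewrite mulr_ge0 ?sqr_ge0.
have t3 : 0 <= 2 / (3 * t ^+ 3) by rewrite divr_ge0// mulr_ge0// exprn_ge0// ltW.
rewrite mulr_ge0_le0//.
have h1 : 0 <= (6 * t - 24) * q / n ^+ 2.
  by rewrite divr_ge0 ?sqr_ge0// mulr_ge0//; lra.
have h2 : 0 <= (3 * t ^+ 2 * s - 6 * t * s + 12 * s + 4 * (s ^+ 2 + 4 * q)) / n.
  rewrite divr_ge0 ?(ltW n0)//.
  have s0 : 0 <= s by rewrite /s; lra.
  have -> : 3 * t ^+ 2 * s - 6 * t * s + 12 * s + 4 * (s ^+ 2 + 4 * q)
     = 3 * (t * s) * (t - 2) + 12 * s + 4 * (s ^+ 2 + 4 * q) by ring.
  have := mulr_ge0 (mulr_ge0 (ltW t0) s0) (_ : 0 <= t - 2).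
  by have := sqr_ge0 s; lra.
lra.
Qed.

(** The radius 8 keeps the argument of the logarithm at least 1 at a point outside
    the disc and at all its neighbours, so that the truncation [Num.max 1] is
    not active there. *)
Lemma log_supermartingale (h : seq (draws 2)) :
  let f g := ln (Num.max 1 (position g ord0 ^+ 2 + position g ord_max ^+ 2 - 7)%:~R : R) in
  64 <= position h ord0 ^+ 2 + position h ord_max ^+ 2 ->
  \sum_c step_prob R h c * f (rcons h c) <= f h.
Proof.
move=> f; rewrite /f => s64; rewrite sum_draws2 /step_prob !big_ord_recl !big_ord0.
have -> : lift ord0 ord0 = ord_max :> 'I_2 by apply/val_inj.
rewrite !position_rcons !ffunE /= !mulr1.
have yn := normr_position h ord0; have zn := normr_position h ord_max.
move: (position h ord0) (position h ord_max) s64 yn zn => y z s64 yn zn.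
have maxE (a b : int) : a = 1 \/ a = -1 -> b = 1 \/ b = -1 ->
    Num.max 1 ((y + a) ^+ 2 + (z + b) ^+ 2 - 7)%:~R =
    (y%:~R ^+ 2 + z%:~R ^+ 2 - 7) + 2 * (a%:~R * y%:~R + b%:~R * z%:~R) + 2 :> R.
  move=> ha hb.
  have a2 : a ^+ 2 = 1 by case: ha => ->.
  have b2 : b ^+ 2 = 1 by case: hb => ->.
  have -> : (y + a) ^+ 2 + (z + b) ^+ 2 - 7 =
      y ^+ 2 + z ^+ 2 - 7 + 2 * (a * y + b * z) + 2.
    by rewrite !sqrrD a2 b2; ring.
  rewrite max_r; first by rewrite !(rmorphD, rmorphM, rmorphN, rmorphXn).
  rewrite ler1z.
  have : (a * y + b * z) ^+ 2 <= 2 * (y ^+ 2 + z ^+ 2).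
    have := sqr_ge0 (a * y - b * z); rewrite sqrrB sqrrD !exprMn a2 b2; lia.
  (* With [A ^+ 2 <= 2 s] and [64 <= s], the increment [2 A] is not below [7 - s]. *)
  move: s64; move: (_ + _) (_ + _) => A s s64 h2; nia.
have -> : Num.max 1 (y ^+ 2 + z ^+ 2 - 7)%:~R = y%:~R ^+ 2 + z%:~R ^+ 2 - 7 :> R.
  rewrite max_r; first by rewrite !(rmorphD, rmorphN, rmorphXn).
  by rewrite ler1z; lia.
rewrite /sign_of !maxE; try by [left|right].
have := @log_drift (size h).+1%:R y%:~R z%:~R (y%:~R ^+ 2 + z%:~R ^+ 2 - 7).
rewrite /= => H; apply: le_trans (H _ _ _ _ _).
- rewrite /draw_prob /sign_of !mul1r !mulN1r !rmorphN /=; exact: lexx.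
- by rewrite ltr0n.
- have : (64 : R) <= (y ^+ 2 + z ^+ 2)%:~R by rewrite -[64]/((64 : int)%:~R) ler_int.
  rewrite !(rmorphD, rmorphXn) /=; lra.
- by ring.
- by rewrite -intr_norm -[leRHS]/((size h).+1%:Z%:~R) ler_int.
- by rewrite -intr_norm -[leRHS]/((size h).+1%:Z%:~R) ler_int.
Qed.

End Lyapunov.

(** * Decay of the point probabilities of one coordinate *)

(** The inductive step of [q_ratio] at [y = 0].  The position [-1] to the left of 0
    carries the same mass [e] as the position 1, by symmetry, and there is no
    ratio to be bounded on this side. *)
Lemma ratio_step0 (R : realFieldType) (N e g : R) : 16 <= N -> 0 <= e ->
  (N - 24) * e <= N * g ->
  (N + 1 - 16) * ((N + 2) * e + (N + 2) * e) <= (N + 1) * (N * e + (N + 4) * g).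
Proof.
move=> N16 e0 Hg; have N0 : 0 < N by lra.
rewrite -(ler_pM2l N0) -subr_ge0.
have -> : N * ((N + 1) * (N * e + (N + 4) * g)) -
    N * ((N + 1 - 16) * ((N + 2) * e + (N + 2) * e)) =
    (N + 1) * (N + 4) * (N * g - (N - 24) * e) +
    (8 * N * (N - 16) + 72 * (N - 16) + 33 * 32) * e by ring.
have N16' : 0 <= N - 16 by lra.
have c1 := mulr_ge0 (ltW N0) N16'.
have c2 : 0 <= 8 * N * (N - 16) + 72 * (N - 16) + 33 * 32 by lra.
have c3 : 0 <= (N + 1) * (N + 4) by apply: mulr_ge0; lra.
have Hg' : 0 <= N * g - (N - 24) * e by lra.
exact: addr_ge0 (mulr_ge0 c3 Hg') (mulr_ge0 c2 e0).
Qed.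

(** The inductive step of [q_ratio] for [y >= 1].  Multiplied by [N * A], the
    difference of the two sides is a nonnegative combination of the two ratio
    bounds plus [P * e], where [P] has nonnegative coefficients as a polynomial in
    [t] and [z], the distances of [N] and [y] to the ends of their ranges. *)
Lemma ratio_step (R : realFieldType) (N y a e g : R) : 1 <= y ->
  8 * (y + 2) <= N -> 0 <= e ->
  (N - 8 * (y + 1)) * a <= N * e -> (N - 8 * (y + 3)) * e <= N * g ->
  (N + 1 - 8 * (y + 2)) * ((N + 2 - y) * a + (N + 2 + y) * e) <=
  (N + 1) * ((N - y) * e + (N + 4 + y) * g).
Proof.
move=> y1 big e0 Ha Hg.
pose t := N - 8 * (y + 2); pose z := y - 1.
have t0 : 0 <= t by rewrite /t; lra.
have z0 : 0 <= z by rewrite /z; lra.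
pose A := N - 8 * (y + 1).
have A0 : 0 < A by rewrite /A; lra.
have N0 : 0 < N by lra.
rewrite -(ler_pM2l (mulr_gt0 N0 A0)) -subr_ge0.
pose P := (49 * 64) * z ^+ 3 + (379 * 64) * z ^+ 2 + 512 * t * z ^+ 2 + (232 * 256) * z
  + (17 * 128) * t * z + 16 * t ^+ 2 * z + 347 * 128 + (109 * 16) * t.
have -> : N * A * ((N + 1) * ((N - y) * e + (N + 4 + y) * g)) -
    N * A * ((N + 1 - 8 * (y + 2)) * ((N + 2 - y) * a + (N + 2 + y) * e)) =
    (N + 1) * A * (N + 4 + y) * (N * g - (N - 8 * (y + 3)) * e) +
    N * (t + 1) * (N + 2 - y) * (N * e - A * a) + P * e.
  by rewrite /P /A /t /z; ring.
have P0 : 0 <= P.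
  have tz := mulr_ge0 t0 z0; have tz2 := mulr_ge0 tz z0.
  have t2z := mulr_ge0 t0 tz; have z2 := mulr_ge0 z0 z0.
  have z3 := mulr_ge0 z2 z0; rewrite /P !exprS expr0 !mulr1; lra.
have c1 : 0 <= (N + 1) * A * (N + 4 + y).
  by apply: mulr_ge0; [apply: mulr_ge0|]; lra.
have c2 : 0 <= N * (t + 1) * (N + 2 - y).
  by apply: mulr_ge0; [apply: mulr_ge0|]; lra.
have Hg' : 0 <= N * g - (N - 8 * (y + 3)) * e by lra.
have Ha' : 0 <= N * e - A * a by rewrite /A; lra.
exact: addr_ge0 (addr_ge0 (mulr_ge0 c1 Hg') (mulr_ge0 c2 Ha')) (mulr_ge0 P0 e0).
Qed.

Section LocalBound.
Variable R : realType.
Variable q : nat -> int -> R.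
(* [q n y] stands for the probability that the centred walk is at [y] after [n]
   draws. *)
Hypothesis q_ge0 : forall n y, 0 <= q n y.
Hypothesis q0 : forall y, q 0 y = (y == -1)%:R.
Hypothesis qS : forall n y, q n.+1 y =
  draw_prob R n (y - 1) true * q n (y - 1) +
  draw_prob R n (y + 1) false * q n (y + 1).
Hypothesis q_sum : forall n (y : nat) J,
  \sum_(j < J) q n (y%:Z + j.*2%:Z) <= 1.

Lemma q_rec n y : 2 * n.+1%:R * q n.+1 y =
  (n%:R + 2 - y%:~R) * q n (y - 1) + (n%:R + 2 + y%:~R) * q n (y + 1).
Proof.
rewrite qS /draw_prob /sign_of mul1r mulN1r !(rmorphD, rmorphN) /= -natr1.
have n0 : n%:R + 1 != 0 :> R by rewrite natr1 pnatr_eq0.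
by field.
Qed.

Lemma q_sym n y : q n.+1 (- y) = q n.+1 y.
Proof.
elim: n y => [|n IH] y.
  rewrite !qS !q0 /draw_prob /sign_of !mul1r !mulN1r.
  have -> : (- y - 1 == -1) = (y == 0) by lia.
  have -> : (y - 1 == -1) = (y == 0) by lia.
  have -> : (- y + 1 == -1) = (y == 2) by lia.
  have -> : (y + 1 == -1) = (y == -2) by lia.
  have [->|y0] := eqVneq y 0; first by rewrite oppr0.
  rewrite !mulr0 !add0r.
  have [->|y2] := eqVneq y 2; first by rewrite /= mulr0 -[_ - _]/(1 - 1%:~R) subrr !mul0r.
  rewrite mulr0.
  have [->|//] := eqVneq y (-2); last by rewrite mulr0.
  by rewrite -[_ - _]/(1 - 1%:~R) subrr !mul0r.
have n0 : 2 * n.+2%:R != 0 :> R by rewrite mulf_neq0 ?pnatr_eq0.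
apply: (mulfI n0); rewrite !q_rec.
have -> : - y - 1 = - (y + 1) by ring.
have -> : - y + 1 = - (y - 1) by ring.
by rewrite !IH rmorphN /=; ring.
Qed.

(** The law is flat on the scale of the square root of [n]: going from [y] to
    [y + 2] loses at most a factor [1 - 8 (y + 2) / n].  For [y]
    small compared with [n] the true loss is about [6 y / n]; a slope larger than
    6 and the shift by 2 leave the room that makes the statement inductive.  Where the factor is not positive
    there is nothing to prove, which covers the start of the induction. *)
Lemma q_ratio (n y : nat) :
  (n.+1%:R - 8 * (y%:R + 2)) * q n.+1 y%:Z <= n.+1%:R * q n.+1 (y%:Z + 2).
Proof.
have trivial_bound (b c u v : R) : b <= 0 -> 0 <= c -> 0 <= u -> 0 <= v ->
    b * u <= c * v.
  by move=> b0 c0 u0 v0; rewrite (le_trans (mulr_le0_ge0 b0 u0))// mulr_ge0.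
elim: n y => [|n IH] y.
  apply: trivial_bound => //; have := ler0n R y; lra.
have N1 : 1 <= n.+1%:R :> R by rewrite ler1n.
have [small|big] := leqP n.+2 (8 * (y + 2)).
  by apply: trivial_bound => //; rewrite subr_le0 -natrD -natrM ler_nat.
have {}big : 8 * (y%:R + 2) <= n.+1%:R :> R by rewrite -natrD -natrM ler_nat.
have c0 : 0 < 2 * n.+2%:R :> R by rewrite mulr_gt0 ?ltr0n.
rewrite -(ler_pM2l c0) ![2 * n.+2%:R * (_ * _)]mulrCA !q_rec.
have -> : y%:Z + 2 - 1 = y%:Z + 1 by ring.
have -> : y%:Z + 2 + 1 = y%:Z + 3 by ring.
rewrite [(y%:Z + 2)%:~R]rmorphD /= -[y%:~R]/(y%:R : R) -[2%:~R]/(2 : R).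
rewrite -(natr1 n.+1).
case: y big => [|y] big.
  rewrite sub0r (q_sym n 1) !add0r.
  have := IH 1%N; rewrite -[1%:Z + 2]/(3%:Z) => H3.
  have big' : 16 <= n.+1%:R :> R.
    by move: big; rewrite add0r; set N := n.+1%:R; lra.
  have H3' : (n.+1%:R - 24) * q n.+1 1 <= n.+1%:R * q n.+1 3.
    have e24 : 8 * (1%:R + 2) = 24 :> R by ring.
    by rewrite -e24.
  have := ratio_step0 big' (q_ge0 _ _) H3'.
  have -> : n.+1%:R + 2 - 2 = n.+1%:R :> R by ring.
  have -> : n.+1%:R + 2 + 2 = n.+1%:R + 4 :> R by ring.
  have -> : n.+1%:R + 1 - 8 * 2 = n.+1%:R + 1 - 16 :> R by ring.
  by rewrite subr0 addr0.
have := IH y; have := IH y.+2.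
have -> : y.+2%:Z + 2 = y.+1%:Z + 3 by lia.
have -> : y%:Z + 2 = y.+1%:Z + 1 by lia.
have -> : y.+2%:Z = y.+1%:Z + 1 by lia.
have -> : y.+1%:Z - 1 = y%:Z by lia.
move=> H3 H1.
have y1 : 1 <= y.+1%:R :> R by rewrite ler1n.
have H1' : (n.+1%:R - 8 * (y.+1%:R + 1)) * q n.+1 y%:Z <=
    n.+1%:R * q n.+1 (y.+1%:Z + 1).
  by apply: le_trans H1; rewrite -(natr1 y) -addrA.
have H3' : (n.+1%:R - 8 * (y.+1%:R + 3)) * q n.+1 (y.+1%:Z + 1) <=
    n.+1%:R * q n.+1 (y.+1%:Z + 3).
  apply: le_trans H3; rewrite -(natr1 y.+1).
  by have -> : y.+1%:R + 3 = y.+1%:R + 1 + 2 :> R by ring.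
have := ratio_step y1 big (q_ge0 _ _) H1' H3'.
have -> : n.+1%:R + 2 - (y.+1%:R + 2) = n.+1%:R - y.+1%:R :> R by ring.
by have -> : n.+1%:R + 2 + (y.+1%:R + 2) = n.+1%:R + 4 + y.+1%:R :> R by ring.
Qed.

(** The ratio bound iterated [j] times: [j ^ 2 + j + j * y] is the sum of the
    [y + 2 * i + 2] over [i < j], and a product of factors [1 - v], [v >= 0],
    is at least 1 minus the sum of the [v] as long as the factors are
    nonnegative. *)
Lemma q_far (n y j : nat) :
  (n.+1%:R - (8 * (j ^ 2 + j + j * y))%:R) * q n.+1 y%:Z <=
  n.+1%:R * q n.+1 (y%:Z + j.*2%:Z).
Proof.
have N0 : 0 < n.+1%:R :> R by rewrite ltr0n.
elim: j => [|j IH]; first by rewrite !mul0n subr0 addr0.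
have := q_ratio n (y + j.*2).
have -> : (y + j.*2)%:Z + 2 = y%:Z + j.+1.*2%:Z by lia.
have -> : (y + j.*2)%:Z = y%:Z + j.*2%:Z by lia.
have -> : 8 * ((y + j.*2)%:R + 2) = (8 * (y + j.*2 + 2))%:R :> R.
  by rewrite natrM [in RHS]natrD.
have -> : (8 * (j.+1 ^ 2 + j.+1 + j.+1 * y) =
           8 * (j ^ 2 + j + j * y) + 8 * (y + j.*2 + 2))%N by lia.
rewrite [(_ + _)%:R]natrD; move: IH.
set U := (8 * (j ^ 2 + _ + _))%:R; set v := (8 * (y + _ + 2))%:R.
have U0 : 0 <= U by exact: ler0n.
have v0 : 0 <= v by exact: ler0n.
have := q_ge0 n.+1 y%:Z; have := q_ge0 n.+1 (y%:Z + j.+1.*2%:Z).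
set a := q _ y%:Z; set b := q _ (_ + j.*2%:Z); set c := q _ (_ + j.+1.*2%:Z).
move: N0; set N := n.+1%:R => N0 c0 a0 hb hc.
have [vN|Nv] := leP v N; last first.
  rewrite (@le_trans _ _ 0)//; last by rewrite mulr_ge0// ltW.
  by apply: mulr_le0_ge0 => //; lra.
rewrite -(ler_pM2l N0).
have h1 : (N - v) * ((N - U) * a) <= (N - v) * (N * b).
  by apply: ler_wpM2l => //; rewrite subr_ge0.
have h2 := ler_wpM2l (ltW N0) hc.
have h3 : 0 <= v * U * a by rewrite !mulr_ge0.
lra.
Qed.

(** By flatness, each of the [J] positions [y], [y + 2], and so on, carries at least
    half of the mass of the first one, and their total mass is at most 1. *)
Lemma q_nat_bound (n y J : nat) : (16 * (y + 2) * J ^ 2 <= n.+1)%N ->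
  J%:R * q n.+1 y%:Z <= 2.
Proof.
move=> Jn.
have N0 : 0 < n.+1%:R :> R by rewrite ltr0n.
suff : \sum_(j < J) q n.+1 y%:Z / 2 <= 1.
  rewrite sumr_const card_ord -mulr_natl; set a := _%:R; lra.
apply: le_trans (q_sum n.+1 y J); apply: ler_sum => j _.
rewrite -(ler_pM2l N0); apply: le_trans (q_far n y j).
rewrite mulrCA mulrC; apply: ler_wpM2r => //.
have : (2 * (8 * (j ^ 2 + j + j * y)))%:R <= n.+1%:R :> R.
  rewrite ler_nat; apply: leq_trans Jn.
  have jJ := ltn_ord j; rewrite -!mulnn.
  have h1 : (j * j <= J * J)%N by rewrite leq_mul// ltnW.
  have h2 : (j <= J * J)%N by nia.
  have h3 : (j * y <= J * J * y)%N by rewrite leq_mul.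
  lia.
by rewrite natrM; set U := (8 * _)%:R; lra.
Qed.

Lemma quadratic_scale (K n : nat) : (0 < K)%N ->
  exists J, (K * J ^ 2 <= n < K * J.+1 ^ 2)%N.
Proof.
move=> K0; elim: n => [|n [J /andP[Jn nJ]]]; first by exists 0%N; rewrite muln0 muln1.
have [lt|ge] := ltnP n.+1 (K * J.+1 ^ 2); first by exists J; rewrite lt ltnW.
by exists J.+1; rewrite ge /=; nia.
Qed.

Lemma q_le1 n (y : nat) : q n y%:Z <= 1.
Proof. by have := q_sum n y 1; rewrite big_ord1 addr0. Qed.

Lemma q_sqrt_bound (Y : nat) n y : `|y| <= Y%:Z ->
  q n.+1 y <= 4 * Num.sqrt (16 * (Y + 2))%:R / Num.sqrt n.+1%:R.
Proof.
move=> yY; pose K := (16 * (Y + 2))%N.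
have K0 : (0 < K)%N by rewrite /K; lia.
rewrite -/K.
have -> : q n.+1 y = q n.+1 `|y|%N%:Z.
  by have [y0|y0] := leP 0 y; [congr q; lia | rewrite -q_sym; congr q; lia].
have {}yY : (`|y|%N <= Y)%N by lia.
have n0 : 0 < Num.sqrt n.+1%:R :> R by rewrite sqrtr_gt0 ltr0n.
rewrite ler_pdivlMr//.
have [J /andP[Jn nJ]] := quadratic_scale n.+1 K0.
have sn : Num.sqrt n.+1%:R <= Num.sqrt K%:R * J.+1%:R :> R.
  have -> : J.+1%:R = Num.sqrt (J.+1%:R ^+ 2) :> R.
    by rewrite sqrtr_sqr ger0_norm.
  rewrite -sqrtrM// ler_sqrt ?mulr_ge0 ?exprn_ge0//.
  by rewrite -natrX -natrM ler_nat ltnW.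
apply: le_trans (ler_wpM2l (q_ge0 _ _) sn) _.
rewrite mulrCA mulrC ler_wpM2r ?sqrtr_ge0//.
case: J {nJ sn} Jn => [|J] Jn.
  rewrite mulr1; apply: le_trans (q_le1 _ _) _; lra.
have qJ : J.+1%:R * q n.+1 `|y|%N%:Z <= 2.
  apply: q_nat_bound; apply: leq_trans Jn; rewrite leq_mul// /K; lia.
have := q_le1 n.+1 `|y|%N.
have : J.+2%:R <= 2 * J.+1%:R :> R by rewrite -natrM ler_nat; lia.
move: qJ; set a := J.+1%:R; set b := J.+2%:R; have := q_ge0 n.+1 `|y|%N%:Z.
set z := q _ _ => z0 h1 h2 _.
have := ler_wpM2l z0 h2; lra.
Qed.

End LocalBound.

(** Comparison with the telescoping series of
    [2 / sqrt n - 2 / sqrt n.+1]. *)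
Lemma sum_inv_sqrt3_le3 (R : realType) n :
  \sum_(k < n.+1) (Num.sqrt k.+1%:R ^+ 3)^-1 <= 3 - 2 / Num.sqrt n.+1%:R :> R.
Proof.
elim: n => [|n IH]; first by rewrite big_ord1 sqrtr1 expr1n invr1; lra.
rewrite big_ord_recr /=; apply: le_trans (lerD IH (lexx _)) _.
have s0 : 0 < Num.sqrt n.+1%:R :> R by rewrite sqrtr_gt0 ltr0n.
have r0 : 0 < Num.sqrt n.+2%:R :> R by rewrite sqrtr_gt0 ltr0n.
have sr : Num.sqrt n.+1%:R <= Num.sqrt n.+2%:R :> R by rewrite ler_sqrt// ler_nat.
have rs : Num.sqrt n.+2%:R ^+ 2 = Num.sqrt n.+1%:R ^+ 2 + 1 :> R.
  by rewrite !sqr_sqrtr// natr1.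
move: s0 r0 sr rs; set s := Num.sqrt n.+1%:R; set r := Num.sqrt n.+2%:R.
move=> s0 r0 sr rs.
suff : (r ^+ 3)^-1 <= 2 / s - 2 / r by lra.
have -> : 2 / s - 2 / r = (2 * (r ^+ 2 - s ^+ 2) * r ^+ 2 / (s * (r + s))) / r ^+ 3.
  by field; rewrite !gt_eqF// addr_gt0.
rewrite ler_pdivlMr ?exprn_gt0// mulVf ?expf_neq0 ?gt_eqF//.
rewrite ler_pdivlMr ?mulr_gt0 ?addr_gt0// rs.
have := mulr_ge0 (ltW s0) (_ : 0 <= r - s).
nra.
Qed.

(** * The law of one urn *)

Section RealProbability.
Context {dT : measure_display} {T : measurableType dT} {R : realType}.
Variable P : probability T R.

Definition pr (A : set T) : R := fine (P A).

Lemma prE A : measurable A -> P A = (pr A)%:E.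
Proof. by move=> mA; rewrite /pr fineK// fin_num_measure. Qed.

Lemma pr_ge0 A : 0 <= pr A.
Proof. by rewrite /pr fine_ge0. Qed.

Lemma pr_le A B : measurable A -> measurable B -> A `<=` B -> pr A <= pr B.
Proof.
by move=> mA mB AB; rewrite -lee_fin -!prE// le_measure ?inE.
Qed.

Lemma pr_le1 A : measurable A -> pr A <= 1.
Proof. by move=> mA; rewrite -lee_fin -prE// probability_le1. Qed.

Lemma pr_setU A B : measurable A -> measurable B -> A `&` B = set0 ->
  pr (A `|` B) = pr A + pr B.
Proof.
move=> mA mB AB; apply: EFin_inj; rewrite EFinD -!prE//; last exact: measurableU.
by rewrite measureU.
Qed.

Lemma pr_partition (C : finType) (Z : T -> C) A : measurable A ->
  (forall c, measurable [set w | Z w = c]) ->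
  pr A = \sum_c pr (A `&` [set w | Z w = c]).
Proof.
move=> mA mZ; have mAZ c : measurable (A `&` [set w | Z w = c]).
  exact: measurableI.
apply: EFin_inj; rewrite -sumEFin -prE//.
under eq_bigr do rewrite -prE//.
rewrite fsbig_seq ?index_enum_uniq// -measure_fin_bigcup//.
- congr (P _); apply/seteqP; split => [w Aw|w [c _] []//].
  by exists (Z w) => //=; rewrite mem_index_enum.
- by move=> b c _ _ [w [[_ <-] [_ <-]]].
Qed.

Lemma pr_disjoint_sum_le1 n (F : 'I_n -> set T) : (forall i, measurable (F i)) ->
  trivIset setT F -> \sum_i pr (F i) <= 1.
Proof.
move=> mF tF; rewrite -lee_fin -sumEFin.
under eq_bigr do rewrite -prE//.
rewrite -measure_bigsetU_ord//; apply: probability_le1.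
exact: bigsetU_measurable.
Qed.

End RealProbability.

Section OneUrn.
Context {dT : measure_display} {T : measurableType dT} {R : realType}.
Variable P : probability T R.
Variable D : nat -> {RV P >-> bool}.

Lemma historyS n w : history D n.+1 w = rcons (history D n w) (D n w).
Proof. exact: mkseqS. Qed.

Lemma size_history n w : size (history D n w) = n.
Proof. exact: size_mkseq. Qed.

Lemma friedman_walk1E n w : friedman_walk1 D n w = centred (history D n w) + 1.
Proof. by rewrite /friedman_walk1 /centred subrK. Qed.

Lemma sigma_process_draw n c : sigma_process D [set w | D n w = c].
Proof.
apply: sub_sigma_algebra; exists n => //; exists [set c] => //.
by rewrite setTI.
Qed.

(** Splitting on the last draw reduces an event about [n.+1] draws to two events
    about [n] draws. *)
Lemma sigma_process_history n (S : seq bool -> Prop) :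
  sigma_process D [set w | S (history D n w)].
Proof.
set G := \bigcup_n preimage_set_system setT (D n) measurable.
elim: n S => [|n IH] S.
  have [S0|S0] := pselect (S [::]).
    have -> : [set w | S (history D 0 w)] = setT by apply/seteqP; split.
    exact: (@measurableT _ (g_sigma_algebraType G)).
  have -> : [set w | S (history D 0 w)] = set0 by apply/seteqP; split.
  exact: (@measurable0 _ (g_sigma_algebraType G)).
have -> : [set w | S (history D n.+1 w)] =
    ([set w | S (rcons (history D n w) true)] `&` [set w | D n w = true]) `|`
    ([set w | S (rcons (history D n w) false)] `&` [set w | D n w = false]).
  apply/seteqP; split => w /=; rewrite historyS.
    by case: (D n w); [left|right].
  by case=> -[Sw ->].
apply: (@measurableU _ (g_sigma_algebraType G)).
  apply: (@measurableI _ (g_sigma_algebraType G)).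
    exact: (IH (fun h => S (rcons h true))).
  exact: sigma_process_draw.
apply: (@measurableI _ (g_sigma_algebraType G)).
  exact: (IH (fun h => S (rcons h false))).
exact: sigma_process_draw.
Qed.

Lemma sigma_process_measurable A : sigma_process D A -> measurable A.
Proof.
apply: smallest_sub; first exact: sigma_algebra_measurable.
by move=> B [n _ [C mC <-]]; exact: measurable_funP.
Qed.

Lemma measurable_history n (S : seq bool -> Prop) :
  measurable [set w | S (history D n w)].
Proof. by apply: sigma_process_measurable; exact: sigma_process_history. Qed.

Lemma measurable_draw n c : measurable [set w | D n w = c].
Proof. by apply: sigma_process_measurable; exact: sigma_process_draw. Qed.

Definition centred_law (n : nat) (y : int) : R :=
  pr P [set w | centred (history D n w) = y].

Hypothesis urnD : friedman_urn D.

Lemma history_draw_prob n h c : size h = n ->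
  pr P [set w | history D n w = h /\ D n w = c] =
  pr P [set w | history D n w = h] * draw_prob R n (centred h) c.
Proof.
move=> hn; apply: EFin_inj; rewrite EFinM.
rewrite -!prE; first by rewrite (urnD c hn) urn_share hn.
  exact: (measurable_history n (fun s => s = h)).
exact: (measurableI _ _ (measurable_history n (fun s => s = h)) (measurable_draw n c)).
Qed.

(** Summation of the defining property of the urn over all histories that lead
    to the same position. *)
Lemma centred_draw_prob n y c :
  pr P ([set w | centred (history D n w) = y] `&` [set w | D n w = c]) =
  draw_prob R n y c * centred_law n y.
Proof.
pose Z w : n.-tuple bool := Tuple (introT eqP (size_history n w)).
have ZE w h : Z w = h <-> history D n w = h.
  by split => [<-//|e]; apply: val_inj.
have mZ h : measurable [set w | Z w = h].
  rewrite [X in measurable X](_ : _ = [set w | history D n w = h]).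
    exact: (measurable_history n (fun s => s = h)).
  by apply/seteqP; split => w /ZE.
have mY := measurable_history n (fun h => centred h = y).
rewrite /centred_law (pr_partition P mY mZ).
rewrite (pr_partition P (measurableI _ _ mY (measurable_draw n c)) mZ).
rewrite mulr_sumr; apply: eq_bigr => h _.
have [hy|hy] := eqVneq (centred h) y.
  rewrite [X in pr P X = _](_ : _ = [set w | history D n w = h /\ D n w = c]).
    rewrite history_draw_prob ?size_tuple// hy mulrC; congr (_ * pr P _).
    apply/seteqP; split => w /= => [wh|[_ /ZE//]].
    by split; [rewrite wh|exact/ZE].
  by apply/seteqP; split => w /=; rewrite ZE; [case=> -[]|case=> -> ->].
rewrite [X in pr P X = _](_ : _ = set0); last first.
  by apply/seteqP; split => // w [[/= wy _] /ZE wh]; case/eqP: hy; rewrite -wh.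
rewrite [X in _ = _ * pr P X](_ : _ = set0); last first.
  by apply/seteqP; split => // w [/= wy /ZE wh]; case/eqP: hy; rewrite -wh.
by rewrite /pr measure0 mulr0.
Qed.

Lemma centred_law_ge0 n y : 0 <= centred_law n y.
Proof. exact: pr_ge0. Qed.

Lemma centred_law0 y : centred_law 0 y = (y == -1)%:R.
Proof.
rewrite /centred_law; have [->|y1] := eqVneq y (-1).
  rewrite [X in pr P X](_ : _ = setT); first by rewrite /pr probability_setT.
  by apply/seteqP; split.
rewrite [X in pr P X](_ : _ = set0); first by rewrite /pr measure0.
by apply/seteqP; split => // w /= e; case/eqP: y1; rewrite -e.
Qed.

Lemma centred_lawS n y : centred_law n.+1 y =
  draw_prob R n (y - 1) true * centred_law n (y - 1) +
  draw_prob R n (y + 1) false * centred_law n (y + 1).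
Proof.
have mY z := measurable_history n (fun h => centred h = z).
rewrite -!centred_draw_prob -pr_setU.
- congr (pr P _); apply/seteqP; split => w /=; rewrite historyS centred_rcons.
    by case: (D n w) => <-; rewrite /sign_of; [left|right]; split => //; lia.
  by case=> -[-> ->]; rewrite /sign_of; lia.
- exact: (measurableI _ _ (mY _) (measurable_draw n _)).
- exact: (measurableI _ _ (mY _) (measurable_draw n _)).
- by apply/seteqP; split => // w [[_ /= ->] [_ /=]].
Qed.

Lemma centred_law_sum n (y : nat) J :
  \sum_(j < J) centred_law n (y%:Z + j.*2%:Z) <= 1.
Proof.
apply: pr_disjoint_sum_le1 => [j|i j _ _ [w [/= -> e]]].
  exact: (measurable_history n (fun h => centred h = y%:Z + j.*2%:Z)).
by apply: val_inj => /=; lia.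
Qed.

End OneUrn.

(** * Transience in dimension at least three *)

Section Joint.
Context {dT : measure_display} {T : measurableType dT} {R : realType}.
Variable P : probability T R.
Variables (d : nat) (D : 'I_d -> nat -> {RV P >-> bool}).
Hypothesis urnD : forall i, friedman_urn (D i).
Hypothesis indD : independent_families P (fun i => sigma_process (D i)).

Lemma pr_independent (A : 'I_d -> set T) : (forall i, sigma_process (D i) (A i)) ->
  pr P [set w | forall i, A i w] = \prod_i pr P (A i).
Proof.
move=> sA; have mA i := sigma_process_measurable (sA i).
have := indD (J := [set: 'I_d]%SET) (fun i _ => sA i).
have -> : \bigcap_(i in [set` [set: 'I_d]%SET]) A i = [set w | forall i, A i w].
  apply/seteqP; split => w /= Aw i; first by apply: Aw; rewrite /= inE.
  by move=> _; exact: Aw.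
rewrite {1}/pr => ->.
have -> : (\prod_(i in [set: 'I_d]%SET) P (A i) = \prod_i P (A i))%E.
  by apply: eq_bigl => i; rewrite inE.
by rewrite (eq_bigr _ (fun i _ => prE P (mA i))) prodEFin.
Qed.

Lemma walk_coord n w x : friedman_walk D n w = x <->
  forall i, centred (history (D i) n w) = x ord0 i - 1.
Proof.
split => [<- i|e]; first by rewrite mxE friedman_walk1E addrK.
by apply/rowP => i; rewrite mxE friedman_walk1E e subrK.
Qed.

Lemma measurable_walk n x : measurable [set w | friedman_walk D n w = x].
Proof.
rewrite (_ : [set w | _] =
    \bigcap_(i in setT) [set w | centred (history (D i) n w) = x ord0 i - 1]).
  apply: fin_bigcap_measurable => // i _.
  exact: (measurable_history (D i) n (fun h => centred h = x ord0 i - 1)).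
apply/seteqP; split => w /=; first by move=> /walk_coord e i _; exact: e.
by move=> e; apply/walk_coord => i; exact: e.
Qed.

(** By independence the walk is at [x] after [n] draws with probability
    [O(n^(- d / 2))], which is summable. *)
Lemma transient_high_dimension : (3 <= d)%N ->
  transient_walk P (friedman_walk D).
Proof.
move=> d3 x _ rec.
pose Y := (\sum_i `|x ord0 i - 1|%N)%N.
pose C : R := 4 * Num.sqrt (16 * (Y + 2))%:R.
have C0 : 0 <= C by rewrite mulr_ge0// sqrtr_ge0.
have xY i : `|x ord0 i - 1| <= Y%:Z.
  by rewrite /Y (bigD1 i)//=; set z := x ord0 i - 1; lia.
pose F n := [set w | friedman_walk D n w = x].
have mF n : measurable (F n) by exact: measurable_walk.
have F3 n : pr P (F n.+1) <= C ^+ 3 * (Num.sqrt n.+1%:R ^+ 3)^-1.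
  have -> : F n.+1 =
      [set w | forall i, centred (history (D i) n.+1 w) = x ord0 i - 1].
    by apply/seteqP; split => w /walk_coord.
  rewrite (@pr_independent
    (fun i => [set w | centred (history (D i) n.+1 w) = x ord0 i - 1])); last first.
    move=> i.
    exact: (sigma_process_history n.+1 (fun h => centred h = x ord0 i - 1)).
  (* Truncating at 1 allows the product over all coordinates to be bounded by
     the product over three of them. *)
  pose m := Num.min 1 (C / Num.sqrt n.+1%:R).
  have Cs0 : 0 <= C / Num.sqrt n.+1%:R by rewrite divr_ge0// sqrtr_ge0.
  have m0 : 0 <= m by rewrite le_min ler01.
  have m1 : m <= 1 by rewrite ge_min lexx.
  apply: (@le_trans _ _ (m ^+ d)).
    rewrite -[d in leRHS]card_ord -prodr_const; apply: ler_prod => i _.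
    rewrite pr_ge0 /= le_min pr_le1 ?measurable_history//=; last first.
      exact: (measurable_history (D i) n.+1 (fun h => centred h = x ord0 i - 1)).
    exact: (@q_sqrt_bound R (centred_law (D i)) (@centred_law_ge0 _ _ _ _ _)
      (@centred_law0 _ _ _ _ _) (centred_lawS (urnD i)) (@centred_law_sum _ _ _ _ _)
      Y n _ (xY i)).
  apply: (@le_trans _ _ (m ^+ 3)); first exact: ler_wiXn2l.
  rewrite -exprVn -exprMn; apply: lerXn2r; rewrite ?nnegrE//.
  by rewrite ge_min lexx orbT.
have bnd n : (\sum_(0 <= k < n) P (F k) <= (1 + C ^+ 3 * 3)%:E)%E.
  have F0 k : P (F k) = (pr P (F k))%:E by exact: prE.
  under eq_bigr do rewrite F0.
  rewrite sumEFin lee_fin.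
  have C30 : 0 <= C ^+ 3 by rewrite exprn_ge0.
  case: n => [|n]; first by rewrite big_nil addr_ge0// mulr_ge0.
  rewrite big_nat_recl// lerD ?pr_le1//.
  case: n => [|n]; first by rewrite big_nil mulr_ge0.
  rewrite big_mkord; apply: (@le_trans _ _ (\sum_(k < n.+1) C ^+ 3 * (Num.sqrt k.+1%:R ^+ 3)^-1)).
    by apply: ler_sum => k _; exact: F3.
  rewrite -mulr_sumr ler_wpM2l//; apply: le_trans (sum_inv_sqrt3_le3 R n) _.
  by rewrite gerBl divr_ge0// sqrtr_ge0.
have : P (lim_sup_set F) = 0%E.
  apply: lim_sup_set_cvg0 => //; apply: le_lt_trans (ltry (1 + C ^+ 3 * 3)).
  apply: lime_le; first by apply: is_cvg_nneseries.
  by apply: nearW => n; exact: bnd.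
move=> e; have : (0 = 1 :> \bar R)%E by rewrite -e; exact: rec.
by move/eqP; rewrite eq_sym onee_eq0.
Qed.

End Joint.

(** * Recurrence in dimensions one and two *)

Section Recurrence.
Context {dT : measure_display} {T : measurableType dT} {R : realType}.
Variable P : probability T R.
Variables (d : nat) (D : 'I_d -> nat -> {RV P >-> bool}).
Hypothesis urnD : forall i, friedman_urn (D i).
Hypothesis indD : independent_families P (fun i => sigma_process (D i)).

Definition joint_history (n : nat) (w : T) : seq (draws d) :=
  mkseq (fun k => [ffun i => D i k w]) n.

Lemma size_joint_history n w : size (joint_history n w) = n.
Proof. exact: size_mkseq. Qed.

Lemma joint_historyS n w :
  joint_history n.+1 w = rcons (joint_history n w) [ffun i => D i n w].
Proof. exact: mkseqS. Qed.

Lemma marginal_joint_history n w i : marginal (joint_history n w) i = history (D i) n w.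
Proof.
by rewrite /marginal /joint_history /mkseq -map_comp; apply: eq_map => k /=; rewrite ffunE.
Qed.

Lemma joint_history_eq n w h : size h = n ->
  joint_history n w = h <-> forall i, history (D i) n w = marginal h i.
Proof.
move=> hn; split => [<- i|e]; first by rewrite marginal_joint_history.
apply: (@eq_from_nth _ [ffun=> false]); first by rewrite size_joint_history.
move=> k; rewrite size_joint_history => kn.
apply/ffunP => i.
have := congr1 (fun s => nth false s k) (e i).
rewrite nth_mkseq// (nth_map [ffun=> false]) ?hn// => <-.
by rewrite nth_mkseq// ffunE.
Qed.

Lemma measurable_joint_history h :
  measurable [set w | joint_history (size h) w = h].
Proof.
rewrite (_ : [set w | _] =
    \bigcap_(i in setT) [set w | history (D i) (size h) w = marginal h i]).
  apply: fin_bigcap_measurable => // i _.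
  exact: (measurable_history (D i) (size h) (fun s => s = marginal h i)).
apply/seteqP; split => w /=.
  by move/(joint_history_eq w erefl) => e i _.
by move=> e; apply/(joint_history_eq w erefl) => i; exact: e.
Qed.

Definition history_law (h : seq (draws d)) : R :=
  pr P [set w | joint_history (size h) w = h].

Lemma history_law_ge0 h : 0 <= history_law h.
Proof. exact: pr_ge0. Qed.

Lemma history_lawE h :
  history_law h = \prod_i pr P [set w | history (D i) (size h) w = marginal h i].
Proof.
rewrite -(pr_independent indD); last first.
  by move=> i; exact: (sigma_process_history (size h) (fun s => s = marginal h i)).
congr (pr P _); apply/seteqP; split => w /=.
  by move/(joint_history_eq w erefl).
by move=> e; apply/(joint_history_eq w erefl).
Qed.

Lemma history_law_rcons h c :
  history_law (rcons h c) = history_law h * step_prob R h c.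
Proof.
rewrite !history_lawE /step_prob -big_split /=; apply: eq_bigr => i _.
rewrite size_rcons /position -(history_draw_prob (urnD i)) ?size_map//.
congr (pr P _); apply/seteqP; split => w /=; rewrite historyS /marginal map_rcons.
  by move/rcons_inj => -[-> ->].
by case=> -> ->.
Qed.

Variable x : 'rV[int]_d.
Hypothesis x_state : walk_state P (friedman_walk D) x.

Definition avoid (m : nat) : set T :=
  [set w | forall k, (m <= k)%N -> friedman_walk D k w <> x].

Lemma measurable_avoid m : measurable (avoid m).
Proof.
rewrite (_ : avoid m = \bigcap_(k in [set k | (m <= k)%N])
    ~` [set w | friedman_walk D k w = x]) //.
apply: bigcap_measurableType => k _; apply: measurableC.
exact: measurable_walk.
Qed.

Definition escape (h : seq (draws d)) : R :=
  pr P ([set w | joint_history (size h) w = h] `&` avoid (size h)).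

Let measurable_escape h :
  measurable ([set w | joint_history (size h) w = h] `&` avoid (size h)).
Proof.
exact: measurableI (measurable_joint_history h) (measurable_avoid _).
Qed.

Lemma escape_le_law h : escape h <= history_law h.
Proof.
by apply: pr_le => //; exact: measurable_joint_history.
Qed.

Let target (i : 'I_d) : int := x ord0 i - 1.

Lemma escape_target h : near_target target 0 h -> escape h <= 0.
Proof.
move=> ht; rewrite /escape [X in pr P X](_ : _ = set0).
  by rewrite /pr measure0.
apply/seteqP; split => // w [/= wh /(_ _ (leqnn _))]; case.
apply/walk_coord => i; have := ht i.
rewrite /position -[in marginal h i]wh marginal_joint_history /target; lia.
Qed.

Lemma measurable_draws n c : measurable [set w | [ffun i => D i n w] = c :> draws d].
Proof.
rewrite (_ : [set w | _] = \bigcap_(i in setT) [set w | D i n w = c i]).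
  by apply: fin_bigcap_measurable => // i _; exact: measurable_draw.
apply/seteqP; split => w /=; first by move=> <- i _; rewrite ffunE.
by move=> e; apply/ffunP => i; rewrite ffunE; exact: e.
Qed.

(** Splitting on the next draw.  The time of [h] itself is no longer among those
    at which [x] is to be avoided, hence an inequality. *)
Lemma escape_step h : escape h <= \sum_c escape (rcons h c).
Proof.
rewrite {1}/escape (pr_partition P (measurable_escape h) (measurable_draws (size h))).
apply: ler_sum => c _; apply: pr_le.
- exact: measurableI (measurable_escape h) (measurable_draws _ _).
- exact: measurable_escape.
- move=> w [[/= wh wa] wc]; split.
    by rewrite /= size_rcons joint_historyS wh wc.
  by rewrite size_rcons => k kh; apply: wa; exact: ltnW.
Qed.

Lemma avoid_null n0 : (forall h, (n0 <= size h)%N -> escape h <= 0) ->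
  forall m, (n0 <= m)%N -> P (avoid m) = 0%E.
Proof.
move=> esc m nm; rewrite (prE P (measurable_avoid m)).
pose Z w : m.-tuple (draws d) := Tuple (introT eqP (size_joint_history m w)).
have ZE h : [set w | Z w = h] = [set w | joint_history (size h) w = h].
  apply/seteqP; split => w /=; first by move=> <-; rewrite size_joint_history.
  by rewrite size_tuple => e; apply: val_inj.
have mZ h : measurable [set w | Z w = h].
  by rewrite ZE; exact: measurable_joint_history.
congr (_%:E); apply/eqP; rewrite eq_le pr_ge0 andbT.
rewrite (pr_partition P (measurable_avoid m) mZ); apply: sumr_le0 => h _.
have := esc h; rewrite size_tuple => /(_ nm); apply: le_trans.
by rewrite /escape setIC ZE size_tuple.
Qed.

Lemma recurrent_of_avoid_null n0 :
  (forall m, (n0 <= m)%N -> P (avoid m) = 0%E) ->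
  recurrent_state P (friedman_walk D) x.
Proof.
move=> a0; rewrite /recurrent_state; set F := fun n => _.
have mF n : measurable (F n) by exact: measurable_walk.
have mL : measurable (lim_sup_set F).
  apply: bigcap_measurableType => n _; apply: bigcup_measurable => k _; exact: mF.
have LE : ~` lim_sup_set F `<=` \bigcup_m avoid (n0 + m).
  move=> w; rewrite /lim_sup_set setC_bigcap => -[m _ /= nw].
  exists m => // k /= mk wk; apply: nw; exists k => //=.
  by apply: leq_trans mk; exact: leq_addl.
have U0 : P (\bigcup_m avoid (n0 + m)) = 0%E.
  apply/eqP; rewrite eq_le measure_ge0 andbT.
  apply: (@le_trans _ _ (\sum_(m <oo) P (avoid (n0 + m)))%E).
    apply: measure_sigma_subadditive => //.
    - by move=> m; exact: measurable_avoid.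
    - by apply: bigcup_measurable => m _; exact: measurable_avoid.
  by rewrite eseries0// => m _ _; apply: a0; exact: leq_addr.
have : P (~` lim_sup_set F) = 0%E.
  apply/eqP; rewrite eq_le measure_ge0 andbT -U0 le_measure ?inE//.
  - exact: measurableC.
  - by apply: bigcup_measurable => m _; exact: measurable_avoid.
rewrite probability_setC// (prE P mL) -EFinB => -[e].
by congr (_%:E); lra.
Qed.

Let K := (\sum_i `|target i|%N)%N.

Lemma target_bound i : `|target i| <= K%:Z.
Proof. by rewrite /K (bigD1 i)//=; lia. Qed.

Lemma target_parity : exists N, forall i, exists W : nat,
  target i + N.+1%:Z = W.*2%:Z.
Proof.
have [n Pn] := x_state; exists n.
have [w /walk_coord wx] : exists w, friedman_walk D n w = x.
  apply: contrapT => nw; move: Pn; rewrite [X in P X](_ : _ = set0).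
    by rewrite measure0 ltxx.
  by apply/seteqP; split => // w wx; apply: nw; exists w.
move=> i; exists (count_mem true (history (D i) n w)).
by rewrite /target -wx -centred_parity size_history.
Qed.

(** The recurrence criterion on the tree of histories, applied to the escape
    masses; the function [f] witnesses that the walk returns to bounded sets. *)
Lemma recurrent_of_lyapunov (f : seq (draws d) -> R) (A : seq (draws d) -> Prop) (r : nat) :
  (forall h, 0 <= f h) ->
  (forall h, ~ A h -> \sum_c step_prob R h c * f (rcons h c) <= f h) ->
  (forall h, A h -> forall i, `|position h i| <= r%:Z) ->
  (forall t, exists k : nat, forall h, f h < t -> forall i, `|position h i| <= k%:Z) ->
  recurrent_state P (friedman_walk D) x.
Proof.
move=> f0 fsup Ar fr.
have [N tN] := target_parity.
have near h k : (forall i, `|position h i| <= k%:Z) -> near_target target (k + K) h.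
  by move=> hk i; have := hk i; have := target_bound i; lia.
apply: (@recurrent_of_avoid_null K.*2).
apply: avoid_null => h hn.
apply: (@lyapunov_recurrence R d history_law history_law_ge0 history_law_rcons
  target K N target_bound tN K.*2 (leqnn _) escape f A (r + K)) => //.
- by move=> g _; exact: escape_le_law.
- by move=> g _; exact: escape_target.
- by move=> g _ _; exact: escape_step.
- by move=> g _; exact: fsup.
- by move=> g Ag; apply: near; exact: Ar.
- move=> t; have [k fk] := fr t; exists (k + K)%N => g gt.
  by apply: near; exact: fk.
Qed.

End Recurrence.

Section LowDimension.
Context {dT : measure_display} {T : measurableType dT} {R : realType}.
Variable P : probability T R.

Lemma recurrent_dimension1 (D : 'I_1 -> nat -> {RV P >-> bool}) :
  (forall i, friedman_urn (D i)) ->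
  independent_families P (fun i => sigma_process (D i)) ->
  recurrent_walk P (friedman_walk D).
Proof.
move=> urnD indD x sx.
apply: (@recurrent_of_lyapunov _ _ _ P 1 D urnD indD x sx
  (fun h => `|position h ord0|%:~R) (fun h => position h ord0 = 0) 0).
- by move=> h; rewrite ler0z.
- by move=> h; exact: abs_supermartingale.
- by move=> h h0 i; rewrite ord1 h0.
- move=> t; exists (Num.bound `|t|) => h ht i; rewrite ord1 -(ler_int R).
  apply/ltW/(lt_trans ht)/(le_lt_trans (ler_norm t)).
  exact: archi_boundP.
Qed.

Lemma recurrent_dimension2 (D : 'I_2 -> nat -> {RV P >-> bool}) :
  (forall i, friedman_urn (D i)) ->
  independent_families P (fun i => sigma_process (D i)) ->
  recurrent_walk P (friedman_walk D).
Proof.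
move=> urnD indD x sx.
pose s (h : seq (draws 2)) := position h ord0 ^+ 2 + position h ord_max ^+ 2.
have pos_le (h : seq (draws 2)) i : `|position h i| ^+ 2 <= s h.
  have [->|->] : i = ord0 \/ i = ord_max.
    by case: i => [[|[|]]] //= p; [left|right]; apply: val_inj.
  - by rewrite /s real_normK ?num_real// lerDl sqr_ge0.
  - by rewrite /s real_normK ?num_real// lerDr sqr_ge0.
apply: (@recurrent_of_lyapunov _ _ _ P 2 D urnD indD x sx
  (fun h => ln (Num.max 1 (s h - 7)%:~R)) (fun h => s h < 64) 8).
- by move=> h; rewrite ln_ge0// le_max lexx.
- by move=> h /negP; rewrite -leNgt; exact: log_supermartingale.
- by move=> h sh i; have := pos_le h i; nia.
- move=> t; exists (Num.bound (expR t) + 7)%N => h ht i.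
  have sb : s h - 7 < (Num.bound (expR t))%:Z.
    rewrite -(ltr_int R); apply: lt_trans (archi_boundP (expR_ge0 t)).
    rewrite -ltr_expR in ht; apply: le_lt_trans ht.
    by rewrite lnK ?le_max ?lexx ?orbT// posrE lt_max ltr01.
  by have := pos_le h i; nia.
Qed.

End LowDimension.

Theorem corollary4p1 (R : realType) (dT : measure_display)
    (T : measurableType dT) (P : probability T R) (d : nat)
    (D : 'I_d -> nat -> {RV P >-> bool}) :
  (1 <= d)%N ->
  (forall i : 'I_d, friedman_urn (D i)) ->
  independent_families P (fun i : 'I_d => sigma_process (D i)) ->
  (d = 1%N \/ d = 2%N -> recurrent_walk P (friedman_walk D)) /\
  ((3 <= d)%N -> transient_walk P (friedman_walk D)).
Proof.
move=> _ urnD indD; split; last exact: transient_high_dimension.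
case=> d12; move: D urnD indD; rewrite d12 => D urnD indD.
  exact: recurrent_dimension1.
exact: recurrent_dimension2.
Qed.
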